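(* Consider the sub-Riemannian optimal control problem of the vertical rolling disc: $\dot c = u_1X_1+u_2X_2$ with $X_1=\partial_\theta$, $X_2=\cos\theta\,\partial_x+\sin\theta\,\partial_y$, minimizing $\frac12\int_0^T(u_1^2+u_2^2)\,dt$. In the coordinates $(x,y,\theta,h_1,h_2,h_3)$ on the cotangent bundle, the normal extremals of this problem are solutions of the system $$\dot h_1=-h_3h_2,\qquad \dot h_2=h_3h_1,\qquad \dot h_3=-h_1h_2,$$ $$\dot x=h_2\cos\theta,\qquad \dot y=h_2\sin\theta,\qquad \dot\theta=h_1 .$$
   Context: The configuration space has coordinates $(x,y,\theta)$, and locally it is identified with the connected, simply connected Lie group $K$ with Lie algebra spanned by the left-invariant fields $X_1=\partial_\theta$, $X_2=\cos\theta\,\partial_x+\sin\theta\,\partial_y$, $X_3:=[X_1,X_2]=-\sin\theta\,\partial_x+\cos\theta\,\partial_y$, which satisfy $[X_1,X_3]=-X_2$, $[X_2,X_3]=0$. The distribution is $\mathcal D=\langle X_1,X_2\rangle$, with the sub-Riemannian metric $k$ on $\mathcal D$ for which $X_1,X_2$ are orthonormal. The vertical coordinates on $T^*K$ are $h_i(f)=\langle f, X_i(g)\rangle$ for $f\in T^*_gK$, $i=1,2,3$; the sign convention for the Poisson bracket is $\{h_i,h_j\}(f)=\langle f,[X_i,X_j]\rangle$. The normal Hamiltonian of Pontryagin's maximum principle is the maximum over $(u_1,u_2)\in\mathbb R^2$ of $u_1h_1+u_2h_2-\frac12(u_1^2+u_2^2)$, that is $H=\frac12(h_1^2+h_2^2)$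 (attained at $u_i=h_i$). A normal extremal is an integral curve of the Hamiltonian vector field of $H$, i.e. a curve in $T^*K$ satisfying $\dot h_i=\{H,h_i\}$ for $i=1,2,3$ and $\dot g=h_1X_1(g)+h_2X_2(g)$, where $g=(x,y,\theta)$ is its projection to $K$. *)

(* Defs.v *)
From HB Require Import structures.
From mathcomp Require Import all_boot all_order all_algebra.
From mathcomp Require Import all_classical all_reals all_analysis.

Set Implicit Arguments.
Unset Strict Implicit.
Unset Printing Implicit Defensive.

Import Order.TTheory GRing.Theory Num.Theory.
Import numFieldNormedType.Exports.

Local Open Scope classical_set_scope.
Local Open Scope ring_scope.

(* The simply connected group K is diffeomorphic to R^3 through the global
   coordinates (x, y, theta), theta being a real number (no identification
   modulo 2 pi).  Hence T^*K is R^3 * R^3: a pair (g, p) is the covector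
   p_0 dx + p_1 dy + p_2 dtheta at g. *)
Definition cotangent (R : realType) := ('rV[R]_3 * 'rV[R]_3)%type.

Definition ix : 'I_3 := @Ordinal 3 0 isT.
Definition iy : 'I_3 := @Ordinal 3 1 isT.
Definition itheta : 'I_3 := @Ordinal 3 2 isT.

Section Geometry.
Variable R : realType.
Implicit Types (g : 'rV[R]_3) (f : cotangent R).

Definition evec (i : 'I_3) : 'rV[R]_3 := delta_mx 0 i.

Definition vector_field := 'rV[R]_3 -> 'rV[R]_3.

(* [X, Y] = DY.X - DX.Y, the sign for which [X, Y] acts on functions as
   X Y - Y X. *)
Definition lie_bracket (X Y : vector_field) : vector_field :=
  fun g => 'D_(X g) Y g - 'D_(Y g) X g.

Definition pairing (p v : 'rV[R]_3) : R := \sum_(i < 3) p 0 i * v 0 i.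

Definition momentum (X : vector_field) : cotangent R -> R :=
  fun f => pairing f.2 (X f.1).

(* Sign convention {p_i, q_j} = delta_ij, that is
   {momentum X, momentum Y} = momentum [X, Y]. *)
Definition poisson_bracket (F G : cotangent R -> R) :
    cotangent R -> R :=
  fun f => \sum_(i < 3)
    ('D_(0, evec i) F f * 'D_(evec i, 0) G f -
     'D_(evec i, 0) F f * 'D_(0, evec i) G f).

(* The vector field on T^*K acting on functions as G |-> {H, G}, given by its
   components along the canonical coordinates (q, p). *)
Definition hamiltonian_field (H : cotangent R -> R) :
    cotangent R -> cotangent R :=
  fun f => (\row_i poisson_bracket H (fun f' => f'.1 0 i) f,
            \row_i poisson_bracket H (fun f' => f'.2 0 i) f).

Definition integral_curve (V : cotangent R -> cotangent R)
    (I : set R) (gamma : R -> cotangent R) : Prop :=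
  forall t, I t -> is_derive t 1 gamma (V (gamma t)).

Definition X1 : vector_field := fun=> evec itheta.
Definition X2 : vector_field := fun g =>
  cos (g 0 itheta) *: evec ix + sin (g 0 itheta) *: evec iy.
Definition X3 : vector_field := lie_bracket X1 X2.

Definition h1 := momentum X1.
Definition h2 := momentum X2.
Definition h3 := momentum X3.

Definition rolling_velocity (u : R * R) : vector_field :=
  fun g => u.1 *: X1 g + u.2 *: X2 g.

Definition running_cost (u : R * R) : R := 2^-1 * (u.1 ^+ 2 + u.2 ^+ 2).

(* Pontryagin's Hamiltonian with the cost multiplier normalized to -1. *)
Definition control_hamiltonian (f : cotangent R) (u : R * R) : R :=
  momentum (rolling_velocity u) f - running_cost u.

(* The supremum is a maximum, attained at u = (h1 f, h2 f). *)
Definition normal_hamiltonian (f : cotangent R) : R :=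
  sup (range (control_hamiltonian f)).

Definition normal_extremal (I : set R) (gamma : R -> cotangent R) :=
  integral_curve (hamiltonian_field normal_hamiltonian) I gamma.

Definition coord_x f : R := f.1 0 ix.
Definition coord_y f : R := f.1 0 iy.
Definition coord_theta f : R := f.1 0 itheta.

End Geometry.

(* Main.v *)
From HB Require Import structures.
Require Import Defs.
From mathcomp Require Import all_boot all_order all_algebra.
From mathcomp Require Import all_classical all_reals all_analysis.
From mathcomp Require Import ring.

Set Implicit Arguments.
Unset Strict Implicit.
Unset Printing Implicit Defensive.

Import Order.TTheory GRing.Theory Num.Theory.
Import numFieldNormedType.Exports.
Local Open Scope classical_set_scope.
Local Open Scope ring_scope.

(** The maximum over the controls is explicit: completing the square gives
    H = (h1^2 + h2^2) / 2 ([normal_hamiltonianE]), because the difference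
    between this value and the control Hamiltonian at u is
    ((u1 - h1)^2 + (u2 - h2)^2) / 2.  In the global coordinates, with covector
    p = (p_x, p_y, p_theta),

      h1 = p_theta,
      h2 = cos theta p_x + sin theta p_y,
      h3 = - sin theta p_x + cos theta p_y,

    the last one since [X1, X2] is the derivative of X2 in theta, X1 being
    constant ([X3E]).  So in any direction (dq, dp) the derivatives are

      dh1 = dp_theta,
      dh2 = cos theta dp_x + sin theta dp_y + dtheta h3,
      dh3 = - sin theta dp_x + cos theta dp_y - dtheta h2,
      dH = h1 dh1 + h2 dh2.

    These formulas are needed twice: in the coordinate directions of T^*K,
    where they give the Hamiltonian field of H, and along an extremal, where
    they give the evolution of the h_i.  Hence they are proved once, for a map
    c from an arbitrary normed space into T^*K and a derivative of c in a
    direction; c = id is the first use and c = gamma the second.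

    The Hamiltonian field has position part h1 X1 + h2 X2, and since H depends
    on the position through theta only, its covector part is
    - h2 h3 dtheta ([normal_hamiltonian_fieldE]).  So p_x and p_y are constant
    along an extremal, and substituting dp_x = dp_y = 0, dp_theta = - h2 h3 and
    dtheta = h1 in the formulas above yields the system. *)

(** * Directional derivatives *)

(** A directional derivative need not come from a differential; restricting to
    the line through x makes the chain rule in one real variable apply. *)
Lemma is_derive_lineP (R : numFieldType) (V W : normedModType R) (f : V -> W)
    (x v : V) (df : W) :
  is_derive x v f df <-> is_derive (0 : R) 1 (fun h : R => f (h *: v + x)) df.
Proof.
have derE : 'D_v f x = 'D_1 (fun h : R => f (h *: v + x)) (0 : R).
  rewrite /derive; set q1 := fun h => h^-1 *: _; set q2 := fun h => h^-1 *: _.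
  suff -> : q1 = q2 by [].
  by apply/funext => h; rewrite /q1 /q2 /= addr0 scale0r add0r [_%:A]mulr1.
split=> -[cvf <-].
  by apply: DeriveDef; [exact: (iffLR (derivable1P _ _ _)) | rewrite derE].
by apply: DeriveDef; [exact: (iffRL (derivable1P _ _ _)) | rewrite derE].
Qed.

(** The difference quotients of L o f are the images by L of those of f, and
    the continuity of L lets them pass to the limit. *)
Lemma is_derive_linear_comp (R : numFieldType) (V W Z : normedModType R)
    (f : V -> W) (L : {linear W -> Z}) (x v : V) (df : W) :
  continuous L -> is_derive x v f df ->
  is_derive x v (fun y => L (f y)) (L df).
Proof.
move=> Lcont [cvf <-].
have Lcvg : (fun h : R => h^-1 *: (((fun y => L (f y)) \o shift x) (h *: v)
    - L (f x))) @ 0^' --> L ('D_v f x).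
  rewrite (_ : (fun h => _) = L \o
      (fun h => h^-1 *: ((f \o shift x) (h *: v) - f x))); last first.
    by apply/funext => h /=; rewrite linearZ/= (linearB L).
  exact: (cvg_comp _ _ cvf (Lcont _)).
apply: DeriveDef; first by apply/cvg_ex; exists (L ('D_v f x)).
exact: cvg_lim.
Qed.

Lemma is_derive_real_comp (R : realType) (V : normedModType R) (phi : R -> R)
    (f : V -> R) (x v : V) (df dphi : R) :
  is_derive (f x) 1 phi dphi -> is_derive x v f df ->
  is_derive x v (fun y => phi (f y)) (dphi * df).
Proof.
move=> phi' /is_derive_lineP f'; apply/is_derive_lineP.
by apply: (@is_derive1_comp R phi (fun h => f (h *: v + x)));
  rewrite ?scale0r ?add0r.
Qed.

Lemma is_deriveZr (R : realType) (V W : normedModType R) (f : V -> R) (w : W)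
    (x v : V) (df : R) :
  is_derive x v f df -> is_derive x v (fun y => f y *: w) (df *: w).
Proof.
(* R^o is R as a normed space over itself, the source of a linear map to W *)
pose L (a : R^o) : W := a *: w.
have Llin : linear L by move=> a b b1; rewrite /L scalerDl scalerA.
pose lL := GRing.isLinear.Build _ _ _ _ L Llin.
pose linL : {linear R^o -> W} := HB.pack L lL.
by apply: (@is_derive_linear_comp _ _ R^o _ f linL); exact: scalel_continuous.
Qed.

Lemma is_derive_coord (R : realType) (V : normedModType R) (n : nat)
    (f : V -> 'rV[R]_n) (x v : V) (df : 'rV[R]_n) (i : 'I_n) :
  is_derive x v f df -> is_derive x v (fun y => f y 0 i) (df 0 i).
Proof.
move=> [f' <-]; apply: DeriveDef; first exact: (iffLR (derivable_mxP _ _ _)).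
by rewrite derive_mx // mxE.
Qed.

(** * Differentiating along a map into the cotangent bundle *)

Section CotangentCoordinates.
Variables (R : realType) (V : normedModType R) (c : V -> cotangent R).
Variables (x v : V) (dc : cotangent R).
Hypothesis c' : is_derive x v c dc.

Lemma is_derive_position (i : 'I_3) :
  is_derive x v (fun s => (c s).1 0 i) (dc.1 0 i).
Proof.
apply: is_derive_coord.
apply: (@is_derive_linear_comp _ _ (cotangent R) _ c fst) => // f.
exact: cvg_fst.
Qed.

Lemma is_derive_covector (i : 'I_3) :
  is_derive x v (fun s => (c s).2 0 i) (dc.2 0 i).
Proof.
apply: is_derive_coord.
apply: (@is_derive_linear_comp _ _ (cotangent R) _ c snd) => // f.
exact: cvg_snd.
Qed.

End CotangentCoordinates.

(** Hamilton's equations dq/dt = dH/dp, dp/dt = - dH/dq: the coordinate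
    functions are linear, so in each Poisson bracket a single term survives. *)
Lemma hamiltonian_fieldE (R : realType) (H : cotangent R -> R) f :
  hamiltonian_field H f = (\row_i 'D_(0, evec R i) H f,
                           \row_i (- 'D_(evec R i, 0) H f)).
Proof.
have dpos (w : cotangent R) i :
    'D_w (fun f' : cotangent R => f'.1 0 i) f = w.1 0 i.
  by have D := is_derive_position (is_derive_id f w) i; rewrite derive_val.
have dcov (w : cotangent R) i :
    'D_w (fun f' : cotangent R => f'.2 0 i) f = w.2 0 i.
  by have D := is_derive_covector (is_derive_id f w) i; rewrite derive_val.
congr pair; apply/rowP => j;
  rewrite !mxE /poisson_bracket (bigD1 j) //= big1 => [|i ij].
- by rewrite !dpos /= !mxE !eqxx/=; ring.
- by rewrite !dpos /= !mxE (eq_sym j) (negbTE ij) ?andbF /=; ring.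
- by rewrite !dcov /= !mxE !eqxx/=; ring.
- by rewrite !dcov /= !mxE (eq_sym j) (negbTE ij) ?andbF /=; ring.
Qed.

(** * The vertical coordinates and the normal Hamiltonian *)

Section Momenta.
Variable R : realType.
Implicit Types f : cotangent R.

Lemma pairing_horizontal (p : 'rV[R]_3) a b :
  pairing p (a *: evec R ix + b *: evec R iy) = a * p 0 ix + b * p 0 iy.
Proof.
rewrite /pairing !big_ord_recl big_ord0 !mxE /=.
rewrite (_ : ord0 = ix); last exact: val_inj.
rewrite (_ : lift ix _ = iy); last exact: val_inj.
rewrite (_ : lift ix _ = itheta); last exact: val_inj.
by ring.
Qed.

Lemma h1E f : h1 f = f.2 0 itheta.
Proof.
rewrite /h1 /momentum /pairing /X1 (bigD1 itheta) //= big1 => [|i it].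
  by rewrite !mxE /=; ring.
by rewrite !mxE (negbTE it) andbF /=; ring.
Qed.

Lemma h2E f :
  h2 f = cos (coord_theta f) * f.2 0 ix + sin (coord_theta f) * f.2 0 iy.
Proof. exact: pairing_horizontal. Qed.

Lemma X3E (g : 'rV[R]_3) : X3 g =
  - sin (g 0 itheta) *: evec R ix + cos (g 0 itheta) *: evec R iy.
Proof.
rewrite /X3 /lie_bracket.
have X1' : 'D_(X2 g) (@X1 R) g = 0.
  by have D := is_derive_cst (evec R itheta) g (X2 g); rewrite derive_val.
rewrite X1' subr0.
have theta' := is_derive_coord itheta (is_derive_id g (X1 g)).
have cos' := is_derive_real_comp (is_derive_cos _) theta'.
have sin' := is_derive_real_comp (is_derive_sin _) theta'.
have dX2 := is_deriveD (is_deriveZr (evec R ix) cos')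
  (is_deriveZr (evec R iy) sin').
have X2' : is_derive g (X1 g) (@X2 R) _ := dX2.
by rewrite derive_val /X1 mxE /= !mulr1.
Qed.

Lemma h3E f :
  h3 f = - sin (coord_theta f) * f.2 0 ix + cos (coord_theta f) * f.2 0 iy.
Proof. by rewrite /h3 /momentum X3E pairing_horizontal. Qed.

(** Completing the square in u bounds the control Hamiltonian by its value at
    u = (h1, h2), so the supremum is this value. *)
Lemma normal_hamiltonianE f :
  normal_hamiltonian f = 2^-1 * (h1 f ^+ 2 + h2 f ^+ 2).
Proof.
have chE u : control_hamiltonian f u =
    u.1 * h1 f + u.2 * h2 f - 2^-1 * (u.1 ^+ 2 + u.2 ^+ 2).
  rewrite /control_hamiltonian /running_cost; congr (_ - _).
  rewrite /h1 /h2 /momentum /pairing /rolling_velocity !mulr_sumr -big_split /=.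
  by apply: eq_bigr => i _; rewrite !mxE; ring.
have ub : ubound (range (control_hamiltonian f))
    (2^-1 * (h1 f ^+ 2 + h2 f ^+ 2)).
  move=> _ [u _ <-]; rewrite chE -subr_ge0.
  rewrite (_ : _ - _ = 2^-1 * ((u.1 - h1 f) ^+ 2 + (u.2 - h2 f) ^+ 2));
    last by field.
  by rewrite mulr_ge0 ?invr_ge0 ?addr_ge0 ?sqr_ge0.
have mem : range (control_hamiltonian f)
    (2^-1 * (h1 f ^+ 2 + h2 f ^+ 2)).
  by exists (h1 f, h2 f) => //; rewrite chE /=; field.
apply/eqP; rewrite eq_le ge_sup //=; last by eexists; exact: mem.
by apply: ub_le_sup => //; eexists; exact: ub.
Qed.

End Momenta.

(** * Evolution of the vertical coordinates *)

Section MomentaDerivatives.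
Variables (R : realType) (V : normedModType R) (c : V -> cotangent R).
Variables (x v : V) (dc : cotangent R).
Hypothesis c' : is_derive x v c dc.

Lemma is_derive_h1 : is_derive x v (fun s => h1 (c s)) (dc.2 0 itheta).
Proof.
rewrite (_ : (fun s => _) = (fun s => (c s).2 0 itheta)); last first.
  by apply/funext => s; rewrite h1E.
exact: is_derive_covector.
Qed.

(** The rotation of X2 towards X3 contributes the term dtheta h3. *)
Lemma is_derive_h2 : is_derive x v (fun s => h2 (c s))
  (cos (coord_theta (c x)) * dc.2 0 ix + sin (coord_theta (c x)) * dc.2 0 iy
   + dc.1 0 itheta * h3 (c x)).
Proof.
have px' := is_derive_covector c' ix.
have py' := is_derive_covector c' iy.
have th' := is_derive_position c' itheta.
have cos' := is_derive_real_comp (is_derive_cos _) th'.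
have sin' := is_derive_real_comp (is_derive_sin _) th'.
have := is_deriveD (is_deriveM cos' px') (is_deriveM sin' py').
rewrite (_ : _ + _ = fun s => h2 (c s)); last first.
  by apply/funext => s; rewrite h2E.
move/is_derive_eq; apply.
by rewrite h3E /coord_theta /GRing.scale /=; ring.
Qed.

(** The rotation of X3 towards - X2 contributes the term - dtheta h2. *)
Lemma is_derive_h3 : is_derive x v (fun s => h3 (c s))
  (- sin (coord_theta (c x)) * dc.2 0 ix + cos (coord_theta (c x)) * dc.2 0 iy
   - dc.1 0 itheta * h2 (c x)).
Proof.
have px' := is_derive_covector c' ix.
have py' := is_derive_covector c' iy.
have th' := is_derive_position c' itheta.
have cos' := is_derive_real_comp (is_derive_cos _) th'.
have sin' := is_derive_real_comp (is_derive_sin _) th'.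
have := is_deriveD (is_deriveM (is_deriveN sin') px') (is_deriveM cos' py').
rewrite (_ : _ + _ = fun s => h3 (c s)); last first.
  by apply/funext => s; rewrite h3E.
move/is_derive_eq; apply.
by rewrite h2E /coord_theta /GRing.scale opprfctE /=; ring.
Qed.

Lemma is_derive_normal_hamiltonian :
  is_derive x v (fun s => normal_hamiltonian (c s))
  (h1 (c x) * dc.2 0 itheta + h2 (c x) *
    (cos (coord_theta (c x)) * dc.2 0 ix + sin (coord_theta (c x)) * dc.2 0 iy
   + dc.1 0 itheta * h3 (c x))).
Proof.
have -> : (fun s => normal_hamiltonian (c s)) =
    2^-1 \*: ((fun s => h1 (c s)) ^+ 2 + (fun s => h2 (c s)) ^+ 2).
  by apply/funext => s; rewrite normal_hamiltonianE.
have sq' := is_deriveD (is_deriveX 2 is_derive_h1) (is_deriveX 2 is_derive_h2).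
by apply: (is_derive_eq (is_deriveZ 2^-1 sq')); rewrite /GRing.scale /=; field.
Qed.

End MomentaDerivatives.

(** H is invariant under translations in x and y, so of the covector only
    p_theta moves. *)
Lemma normal_hamiltonian_fieldE (R : realType) (f : cotangent R) :
  hamiltonian_field (@normal_hamiltonian R) f =
  (h2 f *: X2 f.1 + h1 f *: X1 f.1, - (h2 f * h3 f) *: evec R itheta).
Proof.
have dH (w : cotangent R) := is_derive_normal_hamiltonian (is_derive_id f w).
rewrite hamiltonian_fieldE.
congr pair; apply/rowP => j;
  have Dq := dH (evec R j, 0); have Dp := dH (0, evec R j);
  rewrite !mxE derive_val /= !mxE /coord_theta !eqxx /= !(eq_sym j); ring.
Qed.

Theorem proposition2p3 (R : realType) (I : set R)
    (gamma : R -> cotangent R) :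
  open I -> is_interval I -> normal_extremal I gamma ->
  forall t : R, I t ->
    [/\ is_derive t 1 (fun s => h1 (gamma s)) (- h3 (gamma t) * h2 (gamma t)),
        is_derive t 1 (fun s => h2 (gamma s)) (h3 (gamma t) * h1 (gamma t)) &
        is_derive t 1 (fun s => h3 (gamma s)) (- h1 (gamma t) * h2 (gamma t))] /\
    [/\ is_derive t 1 (fun s => coord_x (gamma s))
          (h2 (gamma t) * cos (coord_theta (gamma t))),
        is_derive t 1 (fun s => coord_y (gamma s))
          (h2 (gamma t) * sin (coord_theta (gamma t))) &
        is_derive t 1 (fun s => coord_theta (gamma s)) (h1 (gamma t))].
Proof.
move=> _ _ extremal t It.
have gamma' := extremal t It.
rewrite normal_hamiltonian_fieldE in gamma'.
split; split.
- by apply: (is_derive_eq (is_derive_h1 gamma')); rewrite /= !mxE /=; ring.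
- by apply: (is_derive_eq (is_derive_h2 gamma')); rewrite /= !mxE /=; ring.
- by apply: (is_derive_eq (is_derive_h3 gamma')); rewrite /= !mxE /=; ring.
- apply: (is_derive_eq (is_derive_position gamma' ix)).
  by rewrite /= !mxE /coord_theta /=; ring.
- apply: (is_derive_eq (is_derive_position gamma' iy)).
  by rewrite /= !mxE /coord_theta /=; ring.
- apply: (is_derive_eq (is_derive_position gamma' itheta)).
  by rewrite /= !mxE /=; ring.
Qed.
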